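(* Let $1\le n\le m$ be integers, let $u_0,u_1,\dots,u_m$ be a sequence of (compact, nonempty) real intervals with $u_m=[0,0]$, and let $\lambda_1,\lambda_2\ge 1$ be such that the interval powers $u_i^{\lambda_1}$ and $(\nabla u_i)^{\lambda_2}$ are defined for $n\le i\le m-1$. If the sequence $(u_i)$ is monotone and $\mu$-decreasing, then $$\sum_{i=n}^{m-1}\Big\|u_i^{\lambda_1}\cdot(\nabla u_i)^{\lambda_2}\Big\|\le \frac{\lambda_2(m-n+1)^{\lambda_1}}{\lambda_1+\lambda_2}\sum_{i=n}^{m}\|\nabla u_i\|^{\lambda_1+\lambda_2}.$$
   Context: An interval is $u=[\underline{u},\overline{u}]=\{t\in\mathbb{R}:\underline{u}\le t\le\overline{u}\}$ with $\underline u\le\overline u$ real; $len(u)=\overline u-\underline u$. Product: $u\cdot v=[\min S,\max S]$ with $S=\{\underline u\,\underline v,\ \underline u\,\overline v,\ \overline u\,\underline v,\ \overline u\,\overline v\}$. gH-difference: $u\ominus_g v=[\min\{\underline u-\underline v,\overline u-\overline v\},\max\{\underline u-\underline v,\overline u-\overline v\}]$. Backward gH-difference operator: $\nabla u_i=u_i\ominus_g u_{i-1}$. Quasi-norm: $\|u\|=\max\{|\underline u|,|\overline u|\}$. Power: $u^{\lambda}=\{t^{\lambda}:t\in u\}$, considered when $t^\lambda$ is defined for all $t\in u$: $\lambda\ge1$ may be any real number if $u\subseteq[0,\infty)$, while $\lambda$ is a positive integer if $u$ contains negative numbers. A sequence $(u_i)$ of intervals is increasing (decreasing) if both real sequences $(\underline{u_i})$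 and $(\overline{u_i})$ are increasing (decreasing), in the weak sense; it is monotone if it is increasing or decreasing. It is $\mu$-decreasing if the real sequence $(len(u_i))$ is decreasing (weakly). An empty sum is $0$. *)

(* Defs.v *)
From HB Require Import structures.
From mathcomp Require Import all_boot all_order all_algebra.
From mathcomp Require Import all_classical all_reals all_analysis.
Set Implicit Arguments.
Unset Strict Implicit.
Unset Printing Implicit Defensive.
Import Order.TTheory GRing.Theory Num.Theory.
Import numFieldNormedType.Exports.
Local Open Scope classical_set_scope.
Local Open Scope ring_scope.

Section Intervals.
Context {R : realType}.
Implicit Types (u v : set R) (t l : R).

Definition seg (a b : R) : set R := [set t | a <= t <= b].

Definition is_itv u : Prop := exists a b : R, a <= b /\ u = seg a b.

(* The end points of a compact interval are its infimum and supremum, see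
   lo_seg and hi_seg below. *)
Definition lo u : R := inf u.
Definition hi u : R := sup u.

Definition len u : R := hi u - lo u.

Definition imul u v : set R :=
  seg (Num.min (Num.min (lo u * lo v) (lo u * hi v))
               (Num.min (hi u * lo v) (hi u * hi v)))
      (Num.max (Num.max (lo u * lo v) (lo u * hi v))
               (Num.max (hi u * lo v) (hi u * hi v))).

Definition gHdiff u v : set R :=
  seg (Num.min (lo u - lo v) (hi u - hi v))
      (Num.max (lo u - lo v) (hi u - hi v)).

(* Only meaningful for 0 < i. *)
Definition nabla (u : nat -> set R) (i : nat) : set R :=
  gHdiff (u i) (u i.-1).

Definition inorm u : R := Num.max `|lo u| `|hi u|.

(* powR is only the right power for a nonnegative base; for t < 0 the power is
   used with l a natural number only, and then l = (Num.truncn l)%:R. *)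
Definition rpow t l : R := if 0 <= t then t `^ l else t ^+ Num.truncn l.

Definition pow_defined u l : Prop :=
  1 <= l /\ ((forall t, u t -> 0 <= t) \/ (exists k : nat, l = k%:R)).

Definition ipow u l : set R := [set rpow t l | t in u].

(* Monotonicity notions for the finite sequence u 0, ..., u m. *)
Definition increasing_upto (m : nat) (u : nat -> set R) : Prop :=
  forall i j : nat, (i <= j <= m)%N -> lo (u i) <= lo (u j) /\ hi (u i) <= hi (u j).

Definition decreasing_upto (m : nat) (u : nat -> set R) : Prop :=
  forall i j : nat, (i <= j <= m)%N -> lo (u j) <= lo (u i) /\ hi (u j) <= hi (u i).

Definition monotone_upto (m : nat) (u : nat -> set R) : Prop :=
  increasing_upto m u \/ decreasing_upto m u.

Definition mu_decreasing_upto (m : nat) (u : nat -> set R) : Prop :=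
  forall i j : nat, (i <= j <= m)%N -> len (u j) <= len (u i).

Lemma segE (a b : R) : seg a b = [set` `[a, b]].
Proof. by apply/seteqP; split => t /=; rewrite in_itv. Qed.

Lemma lo_seg (a b : R) : a <= b -> lo (seg a b) = a.
Proof. by move=> ab; rewrite /lo segE inf_itv // bnd_simp. Qed.

Lemma hi_seg (a b : R) : a <= b -> hi (seg a b) = b.
Proof. by move=> ab; rewrite /hi segE sup_itv // bnd_simp. Qed.

Lemma rpow_nat t (k : nat) : rpow t k%:R = t ^+ k.
Proof. by rewrite /rpow natrK; case: ifP => // t0; rewrite powR_mulrn. Qed.

End Intervals.

(* Main.v *)
Require Import Defs.
From HB Require Import structures.
From mathcomp Require Import all_boot all_order all_algebra.
From mathcomp Require Import all_classical all_reals all_analysis.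
From mathcomp Require Import zify ring lra.
Set Implicit Arguments.
Unset Strict Implicit.
Unset Printing Implicit Defensive.
Import Order.TTheory GRing.Theory Num.Theory.
Import numFieldNormedType.Exports.
Local Open Scope classical_set_scope.
Local Open Scope ring_scope.

(** The sequence runs down to [[0, 0]], so monotonicity makes every [u i] lie
    on one side of the origin, and [inorm (u i)] is the modulus of the end
    point farther from it.  Because the lengths decrease, that same end point
    also moves most from [u i.-1] to [u i], which gives the exact telescoping
    rule [inorm (nabla u i) = inorm (u i.-1) - inorm (u i)] ([inorm_nabla]).
    Both powers and products are controlled by the quasi-norm
    ([inorm_ipow], [inorm_imul]).  With [e k] the norm of [nabla u (m - k)],
    the statement is therefore implied by an inequality for nonnegative reals,
    a discrete form of Opial's inequality ([discrete_opial]), namely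
<<
      sum_(k < h) (sum_(j < k) e j)^p (e k)^q
        <= q h^p / (p + q) * sum_(k < h) (e k)^(p + q),    h = m - n + 1.
>>
    This is proved by induction on [h].  Let [z] be the mean of
    [e 0, ..., e (h - 1)] and [E] the sum of their powers of exponent [p + q].
    The new term [h^p z^p (e h)^q] is split by the weighted Young inequality
    into a multiple of [(e h)^(p + q)], absorbed by the new summand on the
    right, and a multiple of [z^(p + q)].  The latter is absorbed by the growth
    of the constant, since [h z^(p + q) <= E] ([power_mean]) and
    [p h^p <= h ((h + 1)^p - h^p)] ([powR_succ_ge]).  The last two facts both
    say that a convex power lies above its tangents, which is again Young's
    inequality. *)

(** * Inequalities for real powers *)

(** Young's inequality for the conjugate exponents [(a + b) / a] and
    [(a + b) / b].  The case [a = 0], where the first of them degenerates, is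
    included so that tangents to powers of exponent [1] are covered. *)
Lemma weighted_young (R : realType) (a b x y : R) :
  0 <= a -> 0 < b -> 0 <= x -> 0 <= y ->
  (a + b) * (x `^ a * y `^ b) <= a * x `^ (a + b) + b * y `^ (a + b).
Proof.
move=> a0 b0 x0 y0; have [->|an0] := eqVneq a 0.
  by rewrite !add0r powRr0 !mul0r mul1r add0r.
have {a0 an0} a0 : 0 < a by rewrite lt_def an0.
have s0 : 0 < a + b by rewrite addr_gt0.
have := @conjugate_powR R (x `^ a) (y `^ b) ((a + b) / a) ((a + b) / b)
  (powR_ge0 _ _) (powR_ge0 _ _) (divr_gt0 s0 a0) (divr_gt0 s0 b0).
rewrite -!powRrM ![_ * ((a + b) / _)]mulrC !divfK ?gt_eqF// => H.
have {}H := H _.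
rewrite mulrC -ler_pdivlMr//; apply: le_trans (H _) _.
  by rewrite !invf_div -mulrDl divff ?gt_eqF.
by rewrite le_eqVlt; apply/orP; left; apply/eqP; field; lra.
Qed.

(** The graph of [y |-> y^r] lies above its tangent at [x], rearranged so that
    no subtraction of [y] and [x] occurs: this is Young with [b = 1]. *)
Lemma powR_tangent (R : realType) (r x y : R) :
  1 <= r -> 0 <= x -> 0 <= y ->
  r * (x `^ (r - 1) * y) <= (r - 1) * x `^ r + y `^ r.
Proof.
move=> r1 x0 y0.
have := @weighted_young R (r - 1) 1 x y _ ltr01 x0 y0.
by rewrite subrK powRr1// mul1r; apply; rewrite subr_ge0.
Qed.

(** Bernoulli's bound [(h + 1)^r - h^r >= r h^(r - 1)], multiplied by [h] so
    that it stays meaningful at [h = 0]. *)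
Lemma powR_succ_ge (R : realType) (r h : R) :
  1 <= r -> 0 <= h -> r * h `^ r <= h * ((h + 1) `^ r - h `^ r).
Proof.
move=> r1 h0; have r0 : 0 < r by lra.
have := @powR_tangent R r h (h + 1) r1 h0 _.
have E := mulr_powRB1 h0 r0.
rewrite mulrDr mulr1 [X in r * (X + _)]mulrC E => /(_ _) T.
have {}T : r * h `^ (r - 1) <= (h + 1) `^ r - h `^ r.
  by have := T ltac:(lra); lra.
by rewrite -{1}E mulrCA; apply: ler_wpM2l.
Qed.

(** Summing the tangent inequality at the mean [z]: the linear terms cancel.
    The mean is given by [hz] rather than as a quotient, which keeps [h = 0]
    harmless. *)
Lemma power_mean (R : realType) (r z : R) (e : nat -> R) (h : nat) :
  1 <= r -> 0 <= z -> (forall k, 0 <= e k) ->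
  \sum_(k < h) e k = h%:R * z -> h%:R * z `^ r <= \sum_(k < h) e k `^ r.
Proof.
move=> r1 z0 e0 hz; have r0 : 0 < r by lra.
have : \sum_(k < h) r * (z `^ (r - 1) * e k) <=
       \sum_(k < h) ((r - 1) * z `^ r + e k `^ r).
  by apply: ler_sum => k _; apply: powR_tangent.
rewrite -!mulr_sumr hz big_split/= sumr_const card_ord -[_ *+ h]mulr_natl.
have <- := mulr_powRB1 z0 r0; lra.
Qed.

(** Each partial sum stops before [e k], so the first term vanishes; this is
    what lets the constant involve the number [h] of terms and not [h + 1].
    The hypothesis [1 <= q] enters where the growth [q ((h + 1)^p - h^p)] of
    the constant has to dominate [p h^(p - 1)], a bound free of [q]. *)
Lemma discrete_opial (R : realType) (p q : R) (e : nat -> R) (h : nat) :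
  1 <= p -> 1 <= q -> (forall k, 0 <= e k) ->
  (p + q) * \sum_(k < h) (\sum_(j < k) e j) `^ p * e k `^ q <=
  q * h%:R `^ p * \sum_(k < h) e k `^ (p + q).
Proof.
move=> p1 q1 e0; elim: h => [|h IH]; first by rewrite !big_ord0 !mulr0.
rewrite !big_ord_recr/=.
set E := \sum_(k < h) e k `^ (p + q) in IH *.
set S := \sum_(k < h) _ `^ p * _ in IH *.
set y := \sum_(k < h) e k; set z := y / h%:R.
have y0 : 0 <= y by apply: sumr_ge0.
have z0 : 0 <= z by rewrite divr_ge0.
have yz : y = h%:R * z.
  have [h0|hn0] := eqVneq h 0%N; last by rewrite mulrC divfK ?pnatr_eq0.
  by rewrite /y h0 big_ord0 mul0r.
have r1 : 1 <= p + q by lra.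
have M : h%:R * z `^ (p + q) <= E by apply: power_mean yz.
have B := @powR_succ_ge R p h%:R p1 (ler0n _ _).
have Y := @weighted_young R p q z (e h) _ _ z0 (e0 h).
have {}Y := Y ltac:(lra) ltac:(lra).
rewrite yz powRM//.
have -> : h.+1%:R = h%:R + 1 :> R by rewrite -natr1.
have A0 := powR_ge0 (h%:R : R) p.
have Z0 := powR_ge0 z (p + q).
have X0 := powR_ge0 (e h) (p + q).
have h0 := ler0n R h.
have AB : h%:R `^ p <= (h%:R + 1) `^ p :> R.
  by apply: ge0_ler_powR; rewrite ?nnegrE; lra.
(* From here on only polynomial arithmetic in the powers remains. *)
move: (h%:R `^ p) ((h%:R + 1) `^ p) M B A0 h0 AB IH => A C.
move: (z `^ (p + q)) (e h `^ (p + q)) (h%:R : R) Y Z0 X0.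
move=> Z X H Y Z0 X0 M B A0 H0 AC IH.
rewrite -[_ * _ * e h `^ q]mulrA; move: (z `^ p * e h `^ q) Y => T Y.
have AY : A * ((p + q) * T) <= A * (p * Z + q * X) by exact: ler_wpM2l.
have XA : q * (A * X) <= q * (C * X).
  by rewrite ler_wpM2l ?ler_wpM2r//; lra.
have ME : (C - A) * (H * Z) <= (C - A) * E by rewrite ler_wpM2l// subr_ge0.
have BZ : p * A * Z <= H * (C - A) * Z by rewrite ler_wpM2r.
have W0 : 0 <= (C - A) * E.
  by apply: le_trans ME; rewrite !mulr_ge0// subr_ge0.
have W1 : (C - A) * E <= q * ((C - A) * E) by rewrite ler_peMl.
lra.
Qed.

(** * The quasi-norm of intervals *)

Lemma inorm_le (R : realType) (S : set R) (M : R) :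
  S !=set0 -> (forall t, S t -> `|t| <= M) -> inorm S <= M.
Proof.
move=> S0 SM; have [s Ss] := S0.
have lb : lbound S (- M) by move=> t /SM; rewrite ler_norml => /andP[].
have ub : ubound S M by move=> t /SM; rewrite ler_norml => /andP[].
have h1 : - M <= lo S by apply: lb_le_inf.
have h2 : lo S <= s by apply: ge_inf => //; exists (- M).
have h3 : s <= hi S by apply: ub_le_sup => //; exists M.
have h4 : hi S <= M by apply: ge_sup.
by rewrite /inorm ge_max !ler_norml; apply/andP; split; apply/andP; split; lra.
Qed.

Lemma norm_le_inorm (R : realType) (v : set R) (t : R) :
  is_itv v -> v t -> `|t| <= inorm v.
Proof.
move=> [a [b [ab ->]]] /andP[at_ tb].
rewrite /inorm lo_seg// hi_seg// le_max.
have [t0|t0] := leP 0 t; apply/orP; [right|left].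
  by rewrite !ger0_norm//; lra.
by rewrite !ler0_norm//; lra.
Qed.

Lemma inorm_ge0 (R : realType) (v : set R) : 0 <= inorm v.
Proof. by rewrite /inorm le_max normr_ge0. Qed.

(** The end points of the product are among the four products of end points,
    each of which is bounded by the product of the norms. *)
Lemma inorm_imul (R : realType) (v w : set R) :
  inorm (imul v w) <= inorm v * inorm w.
Proof.
have le x y : `|x| <= inorm v -> `|y| <= inorm w ->
    `|x * y| <= inorm v * inorm w by move=> *; rewrite normrM ler_pM.
have [lv hv] : `|lo v| <= inorm v /\ `|hi v| <= inorm v.
  by rewrite /inorm !le_max !lexx orbT.
have [lw hw] : `|lo w| <= inorm w /\ `|hi w| <= inorm w.
  by rewrite /inorm !le_max !lexx orbT.
have := le _ _ lv lw; have := le _ _ lv hw.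
have := le _ _ hv lw; have := le _ _ hv hw; rewrite !ler_norml.
move=> /andP[? ?] /andP[? ?] /andP[? ?] /andP[? ?].
apply: inorm_le => [|t].
  exists (lo v * lo w) => /=.
  by rewrite /imul /seg /= !ge_min !le_max !lexx.
rewrite /imul /seg /= !ge_min !le_max => /andP[lt gt]; rewrite ler_norml.
move: lt gt => /orP[]/orP[] ? /orP[]/orP[] ?; lra.
Qed.

(** Stated as a bound on the set of powers, which avoids discussing whether
    the image is an interval and which of its end points attains the norm. *)
Lemma inorm_ipow (R : realType) (v : set R) (l : R) :
  is_itv v -> pow_defined v l -> inorm (ipow v l) <= inorm v `^ l.
Proof.
move=> iv [l1 vl]; apply: inorm_le.
  have [a [b [ab ->]]] := iv; exists (rpow a l); exists a => //.
  by rewrite /seg/= lexx.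
move=> _ [t vt <-]; apply: (@le_trans _ _ (`|t| `^ l)).
  have [t0|t0] := leP 0 t.
    by rewrite /rpow t0 ger0_norm ?powR_ge0// ger0_norm.
  case: vl => [/(_ _ vt)|[k ->]]; first by lra.
  by rewrite rpow_nat normrX powR_mulrn.
apply: ge0_ler_powR; rewrite ?nnegrE ?inorm_ge0//; first by lra.
exact: norm_le_inorm.
Qed.

(** If the sequence increases to [0], all end points are nonpositive, the norm
    is carried by the lower end point, and decreasing lengths mean that the
    lower end point moves at least as much as the upper one.  The decreasing
    case is the mirror image, with the upper end point. *)
Lemma inorm_nabla (R : realType) (m : nat) (u : nat -> set R) (i : nat) :
  (forall j, (j <= m)%N -> is_itv (u j)) -> u m = seg 0 0 ->
  monotone_upto m u -> mu_decreasing_upto m u ->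
  (0 < i <= m)%N -> inorm (nabla u i) = inorm (u i.-1) - inorm (u i).
Proof.
move=> hu um mono mu /andP[i0 im].
have ii : (i.-1 <= i <= m)%N by rewrite leq_pred.
have im' : (i <= m <= m)%N by rewrite im leqnn.
have := mu _ _ ii.
have lohi j : (j <= m)%N -> lo (u j) <= hi (u j).
  by move=> /hu[a [b [ab ->]]]; rewrite lo_seg// hi_seg.
have := lohi _ im; have := lohi i.-1 (leq_trans (leq_pred _) im).
rewrite /nabla /gHdiff /inorm /len.
rewrite lo_seg ?hi_seg ?ge_min ?le_max ?lexx//.
case: mono => mono; have [+ +] := mono _ _ ii; have [] := mono _ _ im';
  rewrite um lo_seg// hi_seg// => *.
- rewrite min_r; last by lra.
  rewrite [Num.max (lo _ - _) _]max_l; last by lra.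
  rewrite ![`|_ - _|]ger0_norm; try lra.
  rewrite ![`|lo _|]ler0_norm; try lra.
  rewrite ![`|hi _|]ler0_norm; try lra.
  rewrite [LHS]max_r; last by lra.
  by rewrite !max_l; lra.
- rewrite min_r; last by lra.
  rewrite [Num.max (lo _ - _) _]max_l; last by lra.
  rewrite ![`|_ - _|]ler0_norm; try lra.
  rewrite ![`|lo _|]ger0_norm; try lra.
  rewrite ![`|hi _|]ger0_norm; try lra.
  rewrite [LHS]max_l; last by lra.
  by rewrite !max_r; lra.
Qed.

(** * The inequality for interval sequences *)

Theorem theorem3p8 (R : realType) (n m : nat) (u : nat -> set R) (l1 l2 : R)
  (hn : (1 <= n)%N) (hnm : (n <= m)%N)
  (hu : forall i : nat, (i <= m)%N -> is_itv (u i))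
  (hum : u m = seg 0 0)
  (hl1 : 1 <= l1) (hl2 : 1 <= l2)
  (hpow1 : forall i : nat, (n <= i < m)%N -> pow_defined (u i) l1)
  (hpow2 : forall i : nat, (n <= i < m)%N -> pow_defined (nabla u i) l2)
  (hmono : monotone_upto m u)
  (hmu : mu_decreasing_upto m u) :
  \sum_(n <= i < m) inorm (imul (ipow (u i) l1) (ipow (nabla u i) l2))
  <= l2 * (m - n + 1)%:R `^ l1 / (l1 + l2)
     * \sum_(n <= i < m.+1) inorm (nabla u i) `^ (l1 + l2).
Proof.
have nablaE := inorm_nabla hu hum hmono hmu.
(* Time is reversed so that the known value [u m] comes first. *)
set e := fun k => inorm (nabla u (m - k)).
have tail k : (k <= m)%N -> \sum_(j < k) e j = inorm (u (m - k)%N).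
  elim: k => [_|k IH km].
    by rewrite big_ord0 subn0 hum /inorm lo_seg// hi_seg// normr0 maxxx.
  rewrite big_ord_recr/= IH 1?ltnW// /e nablaE ?subn_gt0 ?km ?leq_subr//.
  by rewrite subnS addrC subrK.
have rev (F : nat -> R) :
    \sum_(n <= i < m.+1) F i = \sum_(k < m - n + 1) F (m - k)%N.
  rewrite -{1}[n]add0n big_addn big_nat_rev /= big_mkord addn1 -subSn//.
  apply: eq_bigr => k _; congr F; have := ltn_ord k; lia.
have s0 : 0 < l1 + l2 by lra.
rewrite mulrAC ler_pdivlMr// rev.
apply: le_trans (@discrete_opial R l1 l2 e (m - n + 1) hl1 hl2 _); last first.
  by move=> k; apply: inorm_ge0.
rewrite mulrC ler_pM2l//.
apply: (@le_trans _ _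
  (\sum_(n <= i < m) inorm (u i) `^ l1 * inorm (nabla u i) `^ l2)).
  apply: ler_sum_nat => i him; have [ni im] := andP him.
  apply: le_trans (inorm_imul _ _) _.
  have i_nabla : is_itv (nabla u i).
    by do 2!eexists; split; last reflexivity; rewrite ge_min !le_max !lexx.
  apply: ler_pM; rewrite ?inorm_ge0//; apply: inorm_ipow; auto.
(* The term [i = m], with [inorm (u m) = 0], becomes the empty partial sum. *)
pose F i := inorm (u i) `^ l1 * inorm (nabla u i) `^ l2.
apply: (@le_trans _ _ (\sum_(n <= i < m.+1) F i)).
  by rewrite big_nat_recr//= lerDl mulr_ge0 ?powR_ge0.
rewrite rev le_eqVlt; apply/orP; left; apply/eqP.
apply: eq_bigr => k _; rewrite tail//; have := ltn_ord k; lia.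
Qed.
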